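(* Let $G$ be a finite simple graph with $n$ vertices and $m$ edges, where $n\geq 3$. Let $n_i$ be the number of vertices of neighborhood degree $i$, and let $\delta$ and $\Delta$ be the minimum and maximum neighborhood degree of $G$. Let $M_1=\sum_{u\in V(G)}d(u)^2$. Assume $\Delta-\delta\geq 2$ and $M_1-n\delta=q(\Delta-\delta)+r$, where $q$ is a positive integer and $r$ is an integer with $0\leq r\leq\Delta-\delta-1$. Let $\alpha\in\mathbb{R}$ with $\alpha\notin\{0,1\}$; when $\alpha<0$ assume moreover that $\delta\geq1$ (equivalently, $G$ has no isolated vertices). Put $s_\alpha=\frac{\Delta^\alpha-\delta^\alpha}{\Delta-\delta}$. Then: \begin{enumerate} \item If $r=0$ and $n_\Delta=q$, then every vertex of $G$ has neighborhood degree $\delta$ or $\Delta$. \item If $r\geq1$ and $n_\Delta=q$, then $n_i=0$ for $\delta+r+1\leq i\leq\Delta-1$ and $n_{\delta+r}\leq 1$. \item If $r\geq 1$, ($\alpha<0$ or $\alpha>1$), and $n_{\delta+r}\neq0$, then $NM_\alpha(G)\leq n\delta^\alpha+(M_1-n\delta)s_\alpha+(\delta+r)^\alpha-\delta^\alpha-r s_\alpha$. \item If $r\geq1$, $0<\alpha<1$, and $n_{\delta+r}\neq 0$, then $NM_\alpha(G)\geq n\delta^\alpha+(M_1-n\delta)s_\alpha+(\delta+r)^\alpha-\delta^\alpha-r s_\alpha$. \end{enumerate} In parts (3) and (4), equality holds if $G$ has exactly $q$ vertices of neighborhood degree $\Delta$, exactly one vertex of neighborhood degree $\delta+r$, and $n-q-1$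 vertices of neighborhood degree $\delta$.
   Context: For a vertex $u$ of a graph $G$, $d(u)$ denotes its degree and the neighborhood degree $\delta_G(u)$ is the sum of the degrees of the vertices adjacent to $u$. The first Zagreb index is $M_1(G)=\sum_{u\in V(G)}d(u)^2$. For a real number $\alpha\notin\{0,1\}$, the general neighborhood Zagreb index is $NM_\alpha(G)=\sum_{u\in V(G)}\delta_G(u)^\alpha$. *)

(* Defs.v *)
From HB Require Import structures.
From mathcomp Require Import all_boot all_order all_algebra.
From mathcomp Require Import reals exp.

Set Implicit Arguments.
Unset Strict Implicit.
Unset Printing Implicit Defensive.

Import Order.TTheory GRing.Theory Num.Theory.

Record sgraph := SGraph {
  vertex :> finType;
  adj : rel vertex;
  adj_sym : symmetric adj;
  adj_irr : irreflexive adj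
}.

Arguments adj {s} : rename.

Section NeighborhoodDegree.

Variable G : sgraph.
Implicit Types (u v : G) (i : nat).

Definition edges : {set {set G}} :=
  [set A : {set G} | [exists u, exists v, adj u v && (A == [set u; v])]].

Definition deg u : nat := #|[set v | adj u v]|.

Definition ndeg u : nat := \sum_(v | adj u v) deg v.

Definition max_ndeg : nat := \max_(u : G) ndeg u.

(* The default value [max_ndeg] does not affect the minimum when the graph has
   a vertex: see [min_ndeg_le] and [min_ndeg_attained]. *)
Definition min_ndeg : nat := \big[minn/max_ndeg]_(u : G) ndeg u.

Definition num_ndeg i : nat := #|[set u | ndeg u == i]|.

Definition first_Zagreb : nat := \sum_(u : G) deg u ^ 2.

(* [powR] satisfies [0 `^ a = 0] for every [a != 0], negative [a] included, so
   statements with [a < 0] must exclude neighborhood degree 0. *)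
Definition gen_nbhd_Zagreb (R : realType) (a : R) : R :=
  (\sum_(u : G) (ndeg u)%:R `^ a)%R.

Lemma max_ndeg_ge u : ndeg u <= max_ndeg.
Proof. exact: (@leq_bigmax G ndeg u). Qed.

Lemma max_ndeg_attained : 0 < #|G| -> exists u, ndeg u = max_ndeg.
Proof. by rewrite /max_ndeg => G0; have [u ->] := bigop.eq_bigmax ndeg G0; exists u. Qed.

Lemma min_ndeg_le u : min_ndeg <= ndeg u.
Proof.
rewrite /min_ndeg; elim: (index_enum _) (mem_index_enum u) => // v s IHs.
rewrite inE big_cons geq_min => /predU1P[-> | /IHs ->]; last exact: orbT.
by rewrite leqnn.
Qed.

Lemma min_ndeg_attained : 0 < #|G| -> exists u, ndeg u = min_ndeg.
Proof.
move=> G0; rewrite /min_ndeg.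
elim/big_ind: _ => [|x y [u ux] [v vy]|u _]; first exact: max_ndeg_attained.
  by case: (leqP x y) => _; [exists u | exists v].
by exists u.
Qed.

End NeighborhoodDegree.

(* Main.v *)
Require Import Defs.
From HB Require Import structures.
From mathcomp Require Import all_boot all_order all_algebra.
From mathcomp Require Import unstable interval_inference reals convex exp hoelder.
From mathcomp Require Import zify ring lra.

Set Implicit Arguments.
Unset Strict Implicit.
Unset Printing Implicit Defensive.

Import Order.TTheory GRing.Theory Num.Theory.
Local Open Scope ring_scope.

(** Double counting gives [\sum_u ndeg u = M1], so the excesses [ndeg u - delta]
    add up to [q (Delta - delta) + r].  If [q] vertices have neighborhood degree
    [Delta], the excesses of the others add up to [r], which gives (1) and (2).
    For (3) and (4), compare [x `^ alpha] with its chord over [delta, Delta] at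
    every vertex except one of neighborhood degree [delta + r], whose
    contribution is kept exactly; summing the chord values needs only [M1]. *)

(** * Convexity of powers and the chord inequality *)

Section PowerChord.
Variable R : realType.
Implicit Types (a b p t x : R) (f : R -> R).

Lemma powR_conv_ge1 p a b t : 1 <= p -> 0 <= a -> 0 <= b -> 0 <= t <= 1 ->
  ((1 - t) * a + t * b) `^ p <= (1 - t) * a `^ p + t * b `^ p.
Proof.
move=> p1 a0 b0 /andP[t0 t1].
(* The convex combination puts the weight [t] on its first point, hence the order [b], [a]. *)
have := @convex_powR R p p1 (Itv01 t0 t1) b a.
rewrite !classical_sets.inE /= !in_itv /= !andbT => /(_ b0 a0).
by rewrite convRE [X in X `^ _]convRE /= /onem addrC [X in _ <= X]addrC.
Qed.

Lemma powR_conv_le0 p a b t : p <= 0 -> 0 < a -> 0 < b -> 0 <= t <= 1 ->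
  ((1 - t) * a + t * b) `^ p <= (1 - t) * a `^ p + t * b `^ p.
Proof.
move=> p0 a0 b0 /andP[t0 t1]; pose w := Itv01 t0 t1.
have := concave_ln w b0 a0; have := convex_expR w (p * ln b) (p * ln a).
have := convR_gt0 w b0 a0.
rewrite !convRE /= /onem addrC => x0 cexp cln.
rewrite /powR !gt_eqF// [leRHS]addrC; apply: le_trans cexp.
by rewrite ler_expR; move: (ler_wnM2l p0 cln); lra.
Qed.

(* The inequality for the exponent [p^-1 >= 1], raised to the power [p]. *)
Lemma powR_conv_lt1 p a b t : 0 < p -> p < 1 -> 0 <= a -> 0 <= b ->
  0 <= t <= 1 ->
  (1 - t) * a `^ p + t * b `^ p <= ((1 - t) * a + t * b) `^ p.
Proof.
move=> p0 p1 a0 b0 t01; have /andP[t0 t1] := t01.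
have u0 : 0 <= 1 - t by rewrite subr_ge0.
have pV1 : 1 <= p^-1 by rewrite invf_ge1// ltW.
have := powR_conv_ge1 pV1 (powR_ge0 a p) (powR_ge0 b p) t01.
rewrite -!powRrM divff ?gt_eqF// !powRr1// => cvx.
have := ge0_ler_powR (ltW p0) _ _ cvx; rewrite !nnegrE -powRrM mulVf ?gt_eqF//.
rewrite powRr1 ?addr_ge0 ?mulr_ge0 ?powR_ge0//; exact.
Qed.

Lemma le_chord f a b x : a < b -> a <= x <= b ->
  (forall t, 0 <= t <= 1 -> f ((1 - t) * a + t * b) <= (1 - t) * f a + t * f b) ->
  f x <= f a + (x - a) * ((f b - f a) / (b - a)).
Proof.
move=> ab /andP[ax xb] fconv; have ba0 : 0 < b - a by rewrite subr_gt0.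
have t01 : 0 <= (x - a) / (b - a) <= 1.
  by rewrite divr_ge0 ?subr_ge0 ?(ltW ab)//= ler_pdivrMr// mul1r lerD2r.
have := fconv _ t01; have ba_neq0 : b - a != 0 by rewrite gt_eqF.
set u := (X in f X <= _); have -> : u = x by rewrite /u; field.
by move=> /le_trans; apply; rewrite le_eqVlt; apply/predU1P; left; field.
Qed.

Lemma powR_le_chord p a b x : 0 <= a -> p < 0 /\ 0 < a \/ 1 < p ->
  a < b -> a <= x <= b ->
  x `^ p <= a `^ p + (x - a) * ((b `^ p - a `^ p) / (b - a)).
Proof.
move=> a0 hp ab axb; apply: (@le_chord (@powR R ^~ p)) => // t t01.
case: hp => [[p0 a_gt0]|p1].
  by apply: powR_conv_le0 => //; [exact: ltW | exact: lt_trans ab].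
by apply: powR_conv_ge1 => //; [exact: ltW | exact: le_trans (ltW ab)].
Qed.

Lemma powR_ge_chord p a b x : 0 <= a -> 0 < p < 1 ->
  a < b -> a <= x <= b ->
  a `^ p + (x - a) * ((b `^ p - a `^ p) / (b - a)) <= x `^ p.
Proof.
move=> a0 /andP[p0 p1] ab axb.
(* For [0 < p < 1] the power is concave, so the chord inequality is applied to its opposite. *)
have := @le_chord (fun y => - y `^ p) a b x ab axb.
rewrite -opprD mulNr mulrN -opprD lerN2; apply => t t01.
rewrite !mulrN -opprD lerN2; apply: powR_conv_lt1 => //.
exact: le_trans (ltW ab).
Qed.

End PowerChord.

(** * Termwise comparison of sums away from one index *)

Section SumExcept.
Variables (R : numDomainType) (T : finType) (w : T).
Implicit Types f g : T -> R.

(** The term at [w] is exchanged exactly, so [f w] and [g w] need not be compared. *)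
Lemma ler_sum_except f g : (forall u, u != w -> f u <= g u) ->
  \sum_u f u <= \sum_u g u + f w - g w.
Proof.
move=> fg; rewrite (bigD1 w)//= [X in _ <= X + _ - _](bigD1 w)//=.
rewrite [X in _ <= X](_ : _ = f w + \sum_(u | u != w) g u); last by ring.
by rewrite lerD2l ler_sum.
Qed.

Lemma eq_sum_except f g : (forall u, u != w -> f u = g u) ->
  \sum_u f u = \sum_u g u + f w - g w.
Proof.
move=> fg; rewrite (bigD1 w)//= [X in _ = X + _ - _](bigD1 w)//=.
by rewrite (eq_bigr g)//; ring.
Qed.

End SumExcept.

(** * Counting vertices by neighborhood degree *)

Section NeighborhoodDegreeSums.
Variable G : sgraph.
Implicit Types (u v : G) (i k : nat).
Local Open Scope nat_scope.

(** After exchanging the sums, each [v] contributes [deg v] once for each of its [deg v]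
    neighbors. *)
Lemma sum_ndeg : \sum_(u : G) ndeg u = first_Zagreb G.
Proof.
rewrite /first_Zagreb /ndeg (exchange_big_dep predT)//=.
apply: eq_bigr => v _; rewrite sum_nat_const expnS expn1; congr (_ * _).
by rewrite /deg cardsE; apply: eq_card => u; rewrite !unfold_in adj_sym.
Qed.

Lemma num_ndeg_neq0 i : num_ndeg G i <> 0 -> exists u : G, ndeg u = i.
Proof.
by move/eqP; rewrite cards_eq0 => /set0Pn[u]; rewrite inE => /eqP; exists u.
Qed.

Lemma sum_num_ndeg i (F : nat -> nat) :
  \sum_(u : G | ndeg u == i) F (ndeg u) = num_ndeg G i * F i.
Proof.
rewrite (eq_bigr (fun=> F i)); last by move=> u /eqP ->.
by rewrite sum_nat_const /num_ndeg cardsE.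
Qed.

Lemma sum_excess_below k :
  first_Zagreb G = #|G| * min_ndeg G + num_ndeg G (max_ndeg G) *
    (max_ndeg G - min_ndeg G) + k ->
  \sum_(u : G | ndeg u != max_ndeg G) (ndeg u - min_ndeg G) = k.
Proof.
move=> M1E; have : \sum_(u : G) (ndeg u - min_ndeg G) =
    num_ndeg G (max_ndeg G) * (max_ndeg G - min_ndeg G) + k.
  rewrite sumnB; last by move=> u _; exact: min_ndeg_le.
  by rewrite sum_ndeg sum_nat_const M1E -addnA addKn.
rewrite (bigID (fun u => ndeg u == max_ndeg G)) /=.
by rewrite (@sum_num_ndeg _ (fun x => x - min_ndeg G)) => /addnI.
Qed.

Lemma ndeg_below_le k :
  \sum_(u : G | ndeg u != max_ndeg G) (ndeg u - min_ndeg G) = k ->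
  forall u, ndeg u != max_ndeg G -> ndeg u <= min_ndeg G + k.
Proof.
by move=> <- u uD; rewrite -leq_subLR (bigD1 u)//= leq_addr.
Qed.

(** Each vertex of neighborhood degree [min_ndeg G + k] lies below the maximum and contributes
    [k > 0] to a sum of total [k], so two of them would exceed it. *)
Lemma num_ndeg_below_le1 k :
  0 < k -> min_ndeg G + k < max_ndeg G ->
  \sum_(u : G | ndeg u != max_ndeg G) (ndeg u - min_ndeg G) = k ->
  num_ndeg G (min_ndeg G + k) <= 1.
Proof.
move=> k0 kD; rewrite (bigID (fun u => ndeg u == min_ndeg G + k)) /= => sumk.
rewrite -(leq_pmul2r k0) mul1n -[leqRHS]sumk.
have -> : num_ndeg G (min_ndeg G + k) * k = num_ndeg G (min_ndeg G + k) *
    (min_ndeg G + k - min_ndeg G) by rewrite addKn.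
rewrite -(@sum_num_ndeg _ (fun x => x - min_ndeg G)).
rewrite [X in _ <= X + _](eq_bigl (fun u => ndeg u == min_ndeg G + k)).
  exact: leq_addr.
by move=> u; case: (eqVneq (ndeg u) (_ + k)) => [->|]; rewrite ?andbF// andbT ltn_eqF.
Qed.

(** The three level sets are pairwise disjoint, so their union has at least [#|G|] elements and is
    the whole vertex set. *)
Lemma ndeg_three_values i j k : i != j -> i != k -> j != k ->
  #|G| <= num_ndeg G i + num_ndeg G j + num_ndeg G k ->
  forall u, [\/ ndeg u = i, ndeg u = j | ndeg u = k].
Proof.
move=> ij ik jk; rewrite /num_ndeg => le3 u.
set A := [set u | _ == i] in le3; set B := [set u | _ == j] in le3.
set C := [set u | _ == k] in le3.
have AB0 : A :&: B = set0.
  by apply/setP => v; rewrite !inE; case: eqP => // ->; rewrite (negPf ij).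
have ABC0 : (A :|: B) :&: C = set0.
  apply/setP => v; rewrite !inE; case: (eqVneq (ndeg v) k) => [->|]; rewrite ?andbF//.
  by rewrite andbT eq_sym (negPf ik) eq_sym (negPf jk).
have : #|G| <= #|A :|: B :|: C| by rewrite !cardsU ABC0 AB0 cards0 !subn0.
rewrite -cardsT => cT.
have /eqP/setP/(_ u) : A :|: B :|: C == [set: G] by rewrite eqEcard subsetT.
by rewrite !inE => /orP[/orP[]|] /eqP; [constructor 1|constructor 2|constructor 3].
Qed.

End NeighborhoodDegreeSums.

Theorem theorem3p5 (R : realType) (G : sgraph) (n m q r : nat) (alpha : R)
    (hn : #|G| = n) (hm : #|edges G| = m) (hn3 : (3 <= n)%N) :
  let delta := min_ndeg G in
  let Delta := max_ndeg G in
  let M1 := first_Zagreb G in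
  let s := (Delta%:R `^ alpha - delta%:R `^ alpha) / (Delta%:R - delta%:R) in
  let bound := n%:R * delta%:R `^ alpha + (M1%:R - n%:R * delta%:R) * s
               + (delta + r)%:R `^ alpha - delta%:R `^ alpha - r%:R * s in
  let extremal := [/\ num_ndeg G Delta = q, num_ndeg G (delta + r) = 1%N
                    & num_ndeg G delta = (n - q - 1)%N] in
  (2 <= Delta - delta)%N ->
  M1%:Z - n%:Z * delta%:Z = q%:Z * (Delta%:Z - delta%:Z) + r%:Z ->
  (0 < q)%N ->
  (r <= Delta - delta - 1)%N ->
  alpha != 0 -> alpha != 1 ->
  (alpha < 0 -> (1 <= delta)%N) ->
  [/\ r = 0%N -> num_ndeg G Delta = q ->
        forall u : G, ndeg u = delta \/ ndeg u = Delta,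
      (1 <= r)%N -> num_ndeg G Delta = q ->
        (forall i : nat, (delta + r + 1 <= i <= Delta - 1)%N ->
           num_ndeg G i = 0%N)
        /\ (num_ndeg G (delta + r) <= 1)%N,
      (1 <= r)%N -> alpha < 0 \/ 1 < alpha -> num_ndeg G (delta + r) <> 0%N ->
        gen_nbhd_Zagreb G alpha <= bound
        /\ (extremal -> gen_nbhd_Zagreb G alpha = bound)
    & (1 <= r)%N -> 0 < alpha < 1 -> num_ndeg G (delta + r) <> 0%N ->
        bound <= gen_nbhd_Zagreb G alpha
        /\ (extremal -> gen_nbhd_Zagreb G alpha = bound)].
Proof.
move=> delta Delta M1 s bound extremal Dd M1E q0 rD a0 a1 da.
have dD : (delta < Delta)%N by lia.
have M1nat : M1 = (n * delta + q * (Delta - delta) + r)%N.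
  move: M1E => /eqP; rewrite (subzn (ltnW dD)) subr_eq -!PoszM -!PoszD eqz_nat.
  by move=> /eqP ->; rewrite addnC addnA.
have below_r : num_ndeg G Delta = q ->
    \sum_(u : G | ndeg u != Delta) (ndeg u - delta)%N = r.
  by move=> nDq; apply: sum_excess_below; rewrite nDq hn.
(* [p] is the term of the index at [u], and [c] is the value there of the chord over
   [[delta, Delta]], whose slope is [s]. *)
pose p (u : G) : R := (ndeg u)%:R `^ alpha.
pose c (u : G) : R := delta%:R `^ alpha + ((ndeg u)%:R - delta%:R) * s.
have sum_c : \sum_u c u = n%:R * delta%:R `^ alpha + (M1%:R - n%:R * delta%:R) * s.
  rewrite big_split -mulr_suml sumrB !sumr_const /= hn -natr_sum sum_ndeg.
  by rewrite !mulr_natl.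
(* The bound is the chord sum with the chord value at [w] replaced by the true power. *)
have boundE (w : G) : ndeg w = (delta + r)%N -> bound = \sum_u c u + p w - c w.
  by move=> wr; rewrite sum_c /bound /p /c wr natrD; ring.
have dDR : delta%:R < Delta%:R :> R by rewrite ltr_nat.
have ndegR (u : G) : (delta%:R : R) <= (ndeg u)%:R <= Delta%:R.
  by rewrite !ler_nat min_ndeg_le max_ndeg_ge.
have extremalE (w : G) : (1 <= r)%N -> ndeg w = (delta + r)%N -> extremal ->
    gen_nbhd_Zagreb G alpha = bound.
  (* In the extremal case every vertex other than [w] has neighborhood degree [delta] or [Delta],
     where the chord meets the power. *)
  move=> r0 wr [nD nr nd]; rewrite (boundE w wr); apply: eq_sum_except => u uw.
  have : (#|G| <= num_ndeg G Delta + num_ndeg G (delta + r) + num_ndeg G delta)%N.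
    by rewrite nD nr nd hn; lia.
  rewrite /p /c; case/(ndeg_three_values _ _ _)/(_ u); [lia|lia|lia| | |] => uE.
  - have : Delta%:R - delta%:R != 0 :> R by rewrite subr_eq0 gt_eqF.
    by rewrite uE /s => ?; field.
  (* The vertex of neighborhood degree [delta + r] is unique, so [u] would be [w]. *)
  - move/eqP/cards1P: nr => [z zE]; move/setP: (zE) => /(_ u).
    move/setP: zE => /(_ w); rewrite !inE wr uE eqxx => /esym/eqP <- /esym/eqP uwE.
    by rewrite uwE eqxx in uw.
  - by rewrite uE subrr mul0r addr0.
split.
- move=> r0 nDq u; have [|uD] := eqVneq (ndeg u) Delta; first by right.
  left; apply/eqP; rewrite eqn_leq min_ndeg_le andbT.
  by have := ndeg_below_le (below_r nDq) uD; rewrite r0 addn0.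
- move=> r0 nDq; split; last by apply: num_ndeg_below_le1 => //; [lia | exact: below_r].
  move=> i /andP[ri iD]; have [//|/eqP/num_ndeg_neq0[u uE]] := eqVneq (num_ndeg G i) 0%N.
  have : ndeg u != Delta by lia.
  by move=> /(ndeg_below_le (below_r nDq)); rewrite uE; lia.
- move=> r0 ha /num_ndeg_neq0[w wr]; split; last exact: extremalE wr.
  rewrite (boundE w wr); apply: ler_sum_except => u _; apply: powR_le_chord; rewrite ?ndegR//.
  (* For [alpha < 0] the left end of the chord must be positive, which is what [da] provides. *)
  by case: ha => ha; [left; split; rewrite // ltr0n da | right].
- move=> r0 ha /num_ndeg_neq0[w wr]; split; last exact: extremalE wr.
  rewrite (boundE w wr).
  (* Here the chord lies below the power, so [c] and [p] swap roles and the correction at [w] moves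
     to the other side. *)
  have : \sum_u c u <= \sum_u p u + c w - p w.
    by apply: ler_sum_except => u _; apply: powR_ge_chord; rewrite ?ndegR.
  by rewrite -[gen_nbhd_Zagreb _ _]/(\sum_u p u) lerBrDr => ?; rewrite lerBlDr.
Qed.
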